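(* Let $p$ be a prime, let $a,c\in\mathbb{Q}_p$ with $ac\neq 0$ and $\sqrt{c^2-4a}\in\mathbb{Q}_p$, and let $f(x)=\frac{ax}{x^2+cx+a}$ for $x\in\mathbb{Q}_p$ with $x^2+cx+a\neq 0$. Let $x_1=0$ and $x_2=-c$ be the fixed points of $f$. Let $i\in\{1,2\}$ and $r>0$ be such that the sphere $S_r(x_i)$ is invariant for $f$, and assume that the parameter $a$ belongs to $S_r(x_i)$. Put $h(q)=\frac{3q^2+2q}{6q^3+11q^2+6q+1}$. Then $f$ has the $3$-periodic orbit $\{a,f(a),f^2(a)\}$ if and only if for $i=1$: $(a,c)\in\left\{(h(q),\,q\,h(q)-1): q\in\mathbb{Q}_p\setminus\{0,-1,-\tfrac12,-\tfrac13,-\tfrac23\},\ |h(q)|_p=r\right\}$; for $i=2$: $(a,c)\in\left\{(h(q),\,q\,h(q)-1): q\in\mathbb{Q}_p\setminus\{0,-1,-\tfrac12,-\tfrac13,-\tfrac23\},\ |h(q)(q+1)-1|_p=r\right\}$.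
   Context: $|\cdot|_p$ is the $p$-adic norm on $\mathbb{Q}_p$, and $S_r(s)=\{x\in\mathbb{Q}_p:|x-s|_p=r\}$. A sphere $S_r(s)$ is invariant for $f$ if for every $x\in S_r(s)$ all iterates $f^n(x)$, $n\geq1$, are defined and belong to $S_r(s)$; $f^n$ is the $n$-fold iterate. The set $\{a,f(a),f^2(a)\}$ is a $3$-periodic orbit if $f^3(a)=a$ and $a,f(a),f^2(a)$ are distinct. *)

(* Defs.v *)
From HB Require Import structures.
From mathcomp Require Import all_boot all_order all_algebra ring_quotient.
From mathcomp Require Import zify ring lra.
From mathcomp Require Import all_classical all_reals all_analysis.

Set Implicit Arguments.
Unset Strict Implicit.
Unset Printing Implicit Defensive.

Import Order.TTheory GRing.Theory Num.Theory.
Import numFieldNormedType.Exports.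

Local Open Scope classical_set_scope.
Local Open Scope quotient_scope.
Local Open Scope ring_scope.

Definition padic_abs (p : nat) (x : rat) : rat :=
  if x == 0 then 0
  else p%:R ^ ((logn p `|denq x|)%:Z - (logn p `|numq x|)%:Z).

Section PadicAbs.
Variables (p : nat) (p_pr : prime p).

Let pgt0 : 0 < p%:R :> rat. Proof. by rewrite ltr0n prime_gt0. Qed.
Let pneq0 : p%:R != 0 :> rat. Proof. by rewrite gt_eqF. Qed.
Let pge1 : 1 <= p%:R :> rat. Proof. by rewrite ler1n prime_gt0. Qed.

Lemma padic_abs0 : padic_abs p 0 = 0.
Proof. by rewrite /padic_abs eqxx. Qed.

Lemma padic_abs_gt0 x : x != 0 -> 0 < padic_abs p x.
Proof. by rewrite /padic_abs => /negbTE ->; exact: exprz_gt0. Qed.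

Lemma padic_abs_ge0 x : 0 <= padic_abs p x.
Proof.
have [->|/padic_abs_gt0/ltW//] := eqVneq x 0.
by rewrite padic_abs0.
Qed.

Lemma padic_abs_eq0 x : (padic_abs p x == 0) = (x == 0).
Proof.
have [->|/padic_abs_gt0/gt_eqF//] := eqVneq x 0.
by rewrite padic_abs0 eqxx.
Qed.

Lemma padic_abs_frac (m n : int) : m != 0 -> n != 0 ->
  padic_abs p (m%:~R / n%:~R) = p%:R ^ ((logn p `|n|)%:Z - (logn p `|m|)%:Z).
Proof.
move=> m0 n0; set x : rat := m%:~R / n%:~R.
have x0 : x != 0 by rewrite mulf_neq0 ?invr_eq0 ?intr_eq0.
have nx0 : numq x != 0 by rewrite numq_eq0.
have e : numq x * n = m * denq x.
  apply/(@intr_inj rat); rewrite !rmorphM /=.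
  have := divq_num_den x; rewrite {3}/x => /eqP.
  by rewrite eqr_div ?intr_eq0 ?denq_neq0// => /eqP.
rewrite /padic_abs (negbTE x0); congr (_ ^ _).
have : logn p `|(numq x * n)%R|%N = logn p `|(m * denq x)%R|%N by rewrite e.
rewrite !abszM !lognM ?absz_gt0 ?denq_neq0//; lia.
Qed.

Lemma padic_absM x y : padic_abs p (x * y) = padic_abs p x * padic_abs p y.
Proof.
have [->|x0] := eqVneq x 0; first by rewrite !(mul0r, padic_abs0).
have [->|y0] := eqVneq y 0; first by rewrite !(mulr0, padic_abs0).
have -> : x * y = (numq x * numq y)%:~R / (denq x * denq y)%:~R.
  by rewrite -[in LHS](divq_num_den x) -[in LHS](divq_num_den y) mulf_div !rmorphM.
rewrite padic_abs_frac ?mulf_neq0 ?denq_neq0 ?numq_eq0//.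
rewrite /padic_abs (negbTE x0) (negbTE y0) -expfzDr//; congr (_ ^ _).
rewrite !abszM !lognM ?absz_gt0 ?denq_neq0 ?numq_eq0//; lia.
Qed.

Lemma padic_abs1 : padic_abs p 1 = 1.
Proof. by rewrite /padic_abs oner_eq0 -[1]/(1%:~R) numq_int denq_int subrr. Qed.

Lemma padic_absN x : padic_abs p (- x) = padic_abs p x.
Proof. by rewrite /padic_abs oppr_eq0 numqN denqN abszN. Qed.

Lemma padic_absB x y : padic_abs p (x - y) = padic_abs p (y - x).
Proof. by rewrite -padic_absN opprB. Qed.

Lemma padic_absV x : padic_abs p x^-1 = (padic_abs p x)^-1.
Proof.
have [->|x0] := eqVneq x 0; first by rewrite !(invr0, padic_abs0).
apply: (mulfI (lt0r_neq0 (padic_abs_gt0 x0))).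
by rewrite -padic_absM !divff ?padic_abs1// padic_abs_eq0.
Qed.

Lemma padic_abs_ultra x y :
  padic_abs p (x + y) <= Num.max (padic_abs p x) (padic_abs p y).
Proof.
have [->|x0] := eqVneq x 0; first by rewrite add0r le_max lexx orbT.
have [->|y0] := eqVneq y 0; first by rewrite addr0 le_max lexx.
have [->|xy0] := eqVneq (x + y) 0.
  by rewrite padic_abs0 le_max padic_abs_ge0.
have dx : denq x != 0 by rewrite denq_neq0.
have dy : denq y != 0 by rewrite denq_neq0.
have dxr : (denq x)%:~R != 0 :> rat by rewrite intr_eq0.
have dyr : (denq y)%:~R != 0 :> rat by rewrite intr_eq0.
pose m : int := numq x * denq y; pose n : int := numq y * denq x.
pose k : int := denq x * denq y.
have ex : x = m%:~R / k%:~R.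
  by rewrite -[LHS]divq_num_den /m /k !rmorphM /=; field; rewrite dxr dyr.
have ey : y = n%:~R / k%:~R.
  by rewrite -[LHS]divq_num_den /n /k !rmorphM /=; field; rewrite dxr dyr.
have exy : x + y = (m + n)%:~R / k%:~R by rewrite rmorphD mulrDl -ex -ey.
have k0 : k != 0 by rewrite mulf_neq0.
have m0 : m != 0 by rewrite mulf_neq0 ?numq_eq0.
have n0 : n != 0 by rewrite mulf_neq0 ?numq_eq0.
have mn0 : m + n != 0.
  by apply: contra_neq xy0; rewrite exy => ->; rewrite mul0r.
rewrite exy ex ey !padic_abs_frac// le_max.
have lo : (minn (logn p `|m|) (logn p `|n|) <= logn p `|(m + n)%R|)%N.
  rewrite -pfactor_dvdn ?absz_gt0//.
  set u := minn _ _.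
  have um : (p ^ u %| `|m|)%N by rewrite pfactor_dvdn ?absz_gt0// geq_minl.
  have un : (p ^ u %| `|n|)%N by rewrite pfactor_dvdn ?absz_gt0// geq_minr.
  have um' : ((p ^ u)%N%:Z %| m)%Z by rewrite dvdzE.
  have un' : ((p ^ u)%N%:Z %| n)%Z by rewrite dvdzE.
  by have := rpredD um' un'; rewrite [_ \in _]dvdzE.
have [h|h] := leqP (logn p `|m|) (logn p `|n|).
  apply/orP; left; apply: ler_weXz2l => //.
  by move: lo; rewrite (minn_idPl h); lia.
apply/orP; right; apply: ler_weXz2l => //.
by move: lo; rewrite (minn_idPr (ltnW h)); lia.
Qed.

Lemma padic_absD_lt x y e : padic_abs p x < e -> padic_abs p y < e ->
  padic_abs p (x + y) < e.
Proof.
by move=> xe ye; apply: le_lt_trans (padic_abs_ultra x y) _; rewrite gt_max xe.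
Qed.

Lemma padic_abs_isosceles x y : padic_abs p (x - y) < padic_abs p x ->
  padic_abs p y = padic_abs p x.
Proof.
move=> h; apply/le_anti/andP; split; rewrite leNgt; apply/negP => h'.
  have := padic_abs_ultra (y - x) x.
  by rewrite subrK -padic_absB le_max leNgt (lt_trans h h')/= leNgt h'.
have := padic_abs_ultra (x - y) y.
by rewrite subrK le_max leNgt h/= leNgt h'.
Qed.

End PadicAbs.

Definition padic_cauchy (p : nat) (u : nat -> rat) : Prop :=
  forall e : rat, 0 < e -> exists N, forall m n, (N <= m)%N -> (N <= n)%N ->
    padic_abs p (u m - u n) < e.

Definition padic_null (p : nat) (u : nat -> rat) : Prop :=
  forall e : rat, 0 < e -> exists N, forall n, (N <= n)%N ->
    padic_abs p (u n) < e.

Section PadicSequences.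
Variables (p : nat) (p_pr : prime p).
Implicit Types u v : nat -> rat.

Lemma padic_cauchy_bounded u : padic_cauchy p u ->
  exists2 M, 0 < M & forall n, padic_abs p (u n) < M.
Proof.
move=> /(_ 1 ltr01)[N uN].
pose M := 1 + \sum_(i < N.+1) padic_abs p (u i).
have S0 : 0 <= \sum_(i < N.+1) padic_abs p (u i).
  by apply: sumr_ge0 => i _; exact: padic_abs_ge0.
have hM n : (n <= N)%N -> padic_abs p (u n) < M.
  move=> nN; rewrite /M (bigD1 (Ordinal (n:=N.+1) (m:=n) nN)) //=.
  have : 0 <= \sum_(i < N.+1 | i != Ordinal (n:=N.+1) (m:=n) nN)
       padic_abs p (u i).
    by apply: sumr_ge0 => i _; exact: padic_abs_ge0.
  by lra.
exists M; first by rewrite /M; lra.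
move=> n; have [/hM//|Nn] := leqP n N.
rewrite -[u n](subrK (u N)); apply: padic_absD_lt => //; last exact: hM.
by apply: lt_le_trans (uN _ _ (ltnW Nn) (leqnn N)) _; rewrite /M lerDl.
Qed.

Lemma padic_cauchyB u v :
  padic_cauchy p u -> padic_cauchy p v -> padic_cauchy p (u - v).
Proof.
move=> cu cv e e0; have [N uN] := cu _ e0; have [K vK] := cv _ e0.
exists (maxn N K) => m n; rewrite !geq_max => /andP[Nm Km] /andP[Nn Kn].
have -> : (u - v) m - (u - v) n = (u m - u n) + (v n - v m).
  have E k : (u - v) k = u k - v k by [].
  by rewrite !E; ring.
by apply: padic_absD_lt => //; [exact: uN|exact: vK].
Qed.

Lemma padic_cauchyM u v :
  padic_cauchy p u -> padic_cauchy p v -> padic_cauchy p (u * v).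
Proof.
move=> cu cv e e0.
have [A A0 uA] := padic_cauchy_bounded cu.
have [B B0 vB] := padic_cauchy_bounded cv.
have [N uN] := cu _ (divr_gt0 e0 B0); have [K vK] := cv _ (divr_gt0 e0 A0).
exists (maxn N K) => m n; rewrite !geq_max => /andP[Nm Km] /andP[Nn Kn].
have -> : (u * v) m - (u * v) n = u m * (v m - v n) + (u m - u n) * v n.
  have E k : (u * v) k = u k * v k by [].
  by rewrite !E; ring.
apply: padic_absD_lt => //; rewrite padic_absM//.
  rewrite -[e](@mulfVK _ A) ?gt_eqF// [ltRHS]mulrC.
  by apply: ltr_pM; rewrite ?padic_abs_ge0// vK.
rewrite -[e](@mulfVK _ B) ?gt_eqF//.
by apply: ltr_pM; rewrite ?padic_abs_ge0// uN.
Qed.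

Lemma padic_cauchy1 : padic_cauchy p 1.
Proof. by move=> e e0; exists 0%N => m n _ _; rewrite subrr padic_abs0. Qed.

Lemma padic_nullB u v : padic_null p u -> padic_null p v -> padic_null p (u - v).
Proof.
move=> nu nv e e0; have [N uN] := nu _ e0; have [K vK] := nv _ e0.
exists (maxn N K) => n; rewrite geq_max => /andP[Nn Kn].
by apply: padic_absD_lt => //; rewrite ?uN// padic_absN vK.
Qed.

Lemma padic_nullM u v : padic_cauchy p u -> padic_null p v -> padic_null p (u * v).
Proof.
move=> /padic_cauchy_bounded[A A0 uA] nv e e0.
have [N vN] := nv _ (divr_gt0 e0 A0).
exists N => n Nn; rewrite [(u * v) n]/(u n * v n) padic_absM//.
rewrite -[e](@mulfVK _ A) ?gt_eqF// [ltRHS]mulrC.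
by apply: ltr_pM; rewrite ?padic_abs_ge0// vN.
Qed.

Lemma padic_nonnull u : padic_cauchy p u -> ~ padic_null p u ->
  exists2 d, 0 < d & exists N, forall n, (N <= n)%N -> d <= padic_abs p (u n).
Proof.
move=> cu; apply: contra_notP => h e e0.
have [N uN] := cu _ e0; exists N => n Nn.
apply: contrapT => /negP; rewrite -leNgt => eun; apply: h.
exists e => //; exists N => m Nm; rewrite leNgt; apply/negP => ume.
have := padic_absD_lt p_pr ume (uN n m Nn Nm).
by rewrite addrC subrK ltNge eun.
Qed.

Lemma padic_cauchyV u : padic_cauchy p u -> ~ padic_null p u ->
  padic_cauchy p (fun n => (u n)^-1).
Proof.
move=> cu /(padic_nonnull cu)[d d0 [K uK]] e e0.
have [N uN] := cu _ (mulr_gt0 e0 (mulr_gt0 d0 d0)).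
have u0 n : (K <= n)%N -> u n != 0.
  by move=> /uK h; rewrite -(padic_abs_eq0 p_pr) gt_eqF// (lt_le_trans d0).
exists (maxn N K) => m n; rewrite !geq_max => /andP[Nm Km] /andP[Nn Kn].
have -> : (u m)^-1 - (u n)^-1 = (u n - u m) / (u m * u n).
  by field; rewrite !u0.
rewrite padic_absM// padic_absV// ltr_pdivrMr; last first.
  by rewrite padic_abs_gt0 ?mulf_neq0 ?u0.
apply: lt_le_trans (uN _ _ Nn Nm) _.
rewrite ler_pM2l// padic_absM//.
by apply: ler_pM; rewrite ?(ltW d0)// uK.
Qed.

End PadicSequences.

Definition padic_cauchy_pred (p : nat) (p_pr : prime p) : {pred (nat -> rat)} :=
  fun u => `[< padic_cauchy p u >].

Lemma padic_cauchy_subring p (p_pr : prime p) :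
  subring_closed (padic_cauchy_pred p_pr).
Proof.
split=> [|u v /asboolP cu /asboolP cv|u v /asboolP cu /asboolP cv].
- by apply/asboolP; exact: padic_cauchy1.
- by apply/asboolP; exact: padic_cauchyB.
- by apply/asboolP; exact: padic_cauchyM.
Qed.

HB.instance Definition _ p (p_pr : prime p) :=
  GRing.isSubringClosed.Build (nat -> rat) (padic_cauchy_pred p_pr)
    (padic_cauchy_subring p_pr).

Record cauchy_seq (p : nat) (p_pr : prime p) := CauchySeq {
  cauchy_fun :> nat -> rat;
  cauchy_funP : cauchy_fun \in padic_cauchy_pred p_pr }.

HB.instance Definition _ p (p_pr : prime p) :=
  [isSub for @cauchy_fun p p_pr].
HB.instance Definition _ p (p_pr : prime p) :=
  [Choice of cauchy_seq p_pr by <:].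
HB.instance Definition _ p (p_pr : prime p) :=
  [SubChoice_isSubComNzRing of cauchy_seq p_pr by <:].

Definition null_ideal (p : nat) (p_pr : prime p) : {pred cauchy_seq p_pr} :=
  fun u => `[< padic_null p u >].
Arguments null_ideal {p} p_pr _.

Lemma null_idealP p (p_pr : prime p) : idealr_closed (null_ideal p_pr).
Proof.
split.
- apply/asboolP => e e0; exists 0%N => n _.
  by rewrite padic_abs0.
- apply/asboolP => /(_ 1 ltr01)[N /(_ N (leqnn N))].
  by rewrite padic_abs1 ltxx.
- move=> a u v /asboolP nu /asboolP nv; apply/asboolP.
  have -> : cauchy_fun (a * u + v) =
      cauchy_fun a * cauchy_fun u - (0 - cauchy_fun v).
    by apply/funext => n /=; rewrite opprB addrA subr0.
  apply: padic_nullB => //.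
    by apply: padic_nullM => //; apply/asboolP; exact: cauchy_funP.
  apply: padic_nullB => // e e0; exists 0%N => n _.
  by rewrite padic_abs0.
Qed.

HB.instance Definition _ p (p_pr : prime p) :=
  isIdealr.Build (cauchy_seq p_pr) (null_ideal p_pr) (null_idealP p_pr).

Definition Qp (p : nat) (p_pr : prime p) : Type :=
  {ideal_quot (null_ideal p_pr)}.

Section QpField.
Variables (p : nat) (p_pr : prime p).

HB.instance Definition _ := GRing.ComNzRing.on (Qp p_pr).

Lemma Qp_inv_exists (x : Qp p_pr) : x != 0 -> exists y, y * x = 1.
Proof.
elim/quotW: x => u u0.
have cu : padic_cauchy p u by apply/asboolP; exact: cauchy_funP.
have nu : ~ padic_null p u.
  move=> nu; move/eqP: u0; apply; apply/eqP.
  rewrite -[0](rmorph0 \pi_(Qp p_pr)) -Quotient.idealrBE subr0.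
  exact/asboolP.
have cv : (fun n => (u n)^-1) \in padic_cauchy_pred p_pr.
  by apply/asboolP; exact: padic_cauchyV.
exists (\pi_(Qp p_pr) (CauchySeq cv)).
rewrite -rmorphM -[1](rmorph1 \pi_(Qp p_pr)).
apply/eqP; rewrite -Quotient.idealrBE; apply/asboolP => e e0.
have [d d0 [N uN]] := padic_nonnull p_pr cu nu.
exists N => n Nn /=.
have un0 : u n != 0.
  by rewrite -(padic_abs_eq0 p_pr) gt_eqF// (lt_le_trans d0) ?uN.
rewrite -[X in padic_abs p X]/((u n)^-1 * u n - 1).
by rewrite mulVf// subrr padic_abs0.
Qed.

Definition Qp_inv (x : Qp p_pr) : Qp p_pr := xget 0 [set y | y * x = 1].

Lemma Qp_mulVf (x : Qp p_pr) : x != 0 -> Qp_inv x * x = 1.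
Proof. by move=> /Qp_inv_exists; exact: (@xgetPex _ 0 [set y | y * x = 1]). Qed.

Lemma Qp_invr0 : Qp_inv 0 = 0.
Proof.
by rewrite /Qp_inv; case: xgetP => // y _ /eqP; rewrite mulr0 eq_sym oner_eq0.
Qed.

HB.instance Definition _ :=
  GRing.ComNzRing_isField.Build (Qp p_pr) Qp_mulVf Qp_invr0.

Definition padic_norm (R : realType) (x : Qp p_pr) : R :=
  limn (fun n => ratr (padic_abs p (repr x n)) : R).

(* The choice of the representing Cauchy sequence does not matter. *)
Lemma cvg_padic_norm (R : realType) (u : cauchy_seq p_pr) :
  (ratr (padic_abs p (u n)) : R) @[n --> \oo] -->
  padic_norm R (\pi_(Qp p_pr) u).
Proof.
rewrite /padic_norm; set v := repr _.
have nuv : padic_null p (u \- v).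
  suff : u - v \in null_ideal p_pr by move/asboolP.
  by rewrite Quotient.idealrBE reprK.
have cu : padic_cauchy p u by apply/asboolP; exact: cauchy_funP.
suff [l lu lv] : exists2 l : R,
    (ratr (padic_abs p (u n)) : R) @[n --> \oo] --> l &
    (ratr (padic_abs p (v n)) : R) @[n --> \oo] --> l.
  by rewrite (cvg_lim _ lv).
have [nu|nu] := pselect (padic_null p u).
  have null0 (w : nat -> rat) : padic_null p w ->
      (ratr (padic_abs p (w n)) : R) @[n --> \oo] --> (0 : R).
    move=> nw; apply/cvgrPdist_lt => e e0.
    have [q] := @rat_in_itvoo R 0 e e0; rewrite in_itv /= ltr0q.
    move=> /andP[/nw[N wN] qe].
    exists N => //= n Nn; rewrite sub0r normrN ger0_norm ?ler0q ?padic_abs_ge0//.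
    by apply: lt_trans qe; rewrite ltr_rat wN.
  exists 0; first exact: null0.
  apply: null0; rewrite (_ : cauchy_fun v = u \- (u \- v)); last first.
    by apply/funext => n /=; rewrite subKr.
  exact: padic_nullB.
have [d d0 [N uN]] := padic_nonnull p_pr cu nu.
have [K uK] := cu _ d0; have [L uL] := nuv _ d0.
pose M := maxn N (maxn K L).
exists (ratr (padic_abs p (u M))).
  apply: cvg_near_cst; exists M => //= n; rewrite /= !geq_max => /and3P[Nn Kn Ln].
  congr ratr; apply: padic_abs_isosceles => //.
  by apply: lt_le_trans (uN M _); [apply: uK|]; rewrite ?leq_max ?leqnn ?orbT.
apply: cvg_near_cst; exists M => //= n; rewrite /= !geq_max => /and3P[Nn Kn Ln].
congr ratr; rewrite (@padic_abs_isosceles _ p_pr (u n)).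
  apply: padic_abs_isosceles => //.
  by apply: lt_le_trans (uN M _); [apply: uK|]; rewrite ?leq_max ?leqnn ?orbT.
by apply: lt_le_trans (uN n _) => //; exact: uL.
Qed.

Definition padic_sphere (R : realType) (s : Qp p_pr) (r : R) : set (Qp p_pr) :=
  [set x | padic_norm R (x - s) = r].

End QpField.

(* A partial self-map of T is a map T -> option T; piter g n x is None as soon
   as one of the first n applications of g is undefined. *)
Definition piter (T : Type) (g : T -> option T) (n : nat) (x : T) : option T :=
  iter n (obind g) (Some x).

Definition invariant_set (T : Type) (g : T -> option T) (S : set T) : Prop :=
  forall x, S x -> forall n, (0 < n)%N -> exists2 y, piter g n x = Some y & S y.

(* As g^3(x) is defined, so are g(x) and g^2(x). *)
Definition has_3periodic_orbit (T : eqType) (g : T -> option T) (x : T) : Prop :=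
  piter g 3 x = Some x /\
  [/\ piter g 0 x != piter g 1 x, piter g 1 x != piter g 2 x
    & piter g 0 x != piter g 2 x].

Definition f_ac (K : fieldType) (a c : K) (x : K) : option K :=
  if x ^+ 2 + c * x + a == 0 then None
  else Some (a * x / (x ^+ 2 + c * x + a)).

Definition h (K : fieldType) (q : K) : K :=
  (3 * q ^+ 2 + 2 * q) / (6 * q ^+ 3 + 11 * q ^+ 2 + 6 * q + 1).

Definition excluded (K : fieldType) : seq K :=
  [:: 0; -1; - (1 / 2); - (1 / 3); - (2 / 3)].

(* Main.v *)
Require Import Defs.
From mathcomp Require Import all_boot all_order all_algebra ring_quotient.
From mathcomp Require Import ring zify.
From mathcomp Require Import all_classical all_reals all_analysis.

Import Order.TTheory GRing.Theory Num.Theory.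
Import numFieldNormedType.Exports.

Local Open Scope classical_set_scope.
Local Open Scope quotient_scope.
Local Open Scope ring_scope.

(** Write [c = q a - 1], that is [q = (c + 1) / a]. Then [f a = 1 / (q + 1)],
  and with [b = a (q + 1)] the equation [f^3 a = a] becomes
    [(b - 1) ((2 q + 1) (3 q + 1) b - q (3 q + 2)) = 0].
  The factor [b - 1] vanishes exactly when [a] is the nonzero fixed point,
  i.e. [a + c = 0]; the other one says [a = h q], because the denominator of
  [h] is [(q + 1) (2 q + 1) (3 q + 1)]. This computation is valid over every
  field in which 2 and 3 are invertible ([f_ac_3periodicP]). The conditions on
  the norm of [h q] or of [h q (q + 1) - 1] merely repeat that [a], or
  [a + c], has norm [r].

  The one delicate point is that [a = h q] does not prevent [a + c = 0]. When
  the sphere is centred at [-c] this is impossible, since [a + c] has norm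
  [r > 0]. When it is centred at 0, [a + c = 0] and [a = h q] force
  [a^2 - 3 a + 3 = 0] ([h_fixed]), which does have solutions in some [Q_p]:
  here the invariance of the sphere is needed. For p = 3 the equation has no
  solution, since [(2 a - 3)^2 = -3] would have norm 1/3, which is not an even
  power of 3. For the other p, [a] is a unit, and the poles of [f] are two
  p-adic numbers (the discriminant is a square) with sum and product equal to
  [a]; they are units as well, so they lie on the sphere, and it is not
  invariant ([fixed_parameter_not_invariant]). The p-adic norm enters only
  through its multiplicativity, the ultrametric inequality and its value
  group. *)

(** * The period-three equation over a field *)

Lemma f_acP (K : fieldType) (a c x y : K) :
  f_ac a c x = Some y <->
  x ^+ 2 + c * x + a != 0 /\ y * (x ^+ 2 + c * x + a) = a * x.
Proof.
rewrite /f_ac; case: eqVneq => [_|D0]; first by split=> [|[]].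
split=> [[<-]|[_ <-]]; first by rewrite mulfVK.
by rewrite mulfK.
Qed.

Lemma f_ac_fixed (K : fieldType) (a c : K) : a != 0 ->
  f_ac a c a = Some a <-> a + c = 0.
Proof.
move=> a0; rewrite f_acP.
have -> : a ^+ 2 + c * a + a = a * (a + c + 1) by ring.
split=> [[_ /(mulfI a0)]|->]; last by rewrite add0r mulr1.
by rewrite -[RHS]mulr1 => /(mulfI a0) /eqP; rewrite -subr_eq0 addrK => /eqP.
Qed.

(** Three being prime, an orbit closing up after three steps can only collapse
  to a fixed point. *)
Lemma has_3periodic_orbit_notfixed (T : eqType) (g : T -> option T) (x : T) :
  has_3periodic_orbit g x <-> piter g 3 x = Some x /\ g x <> Some x.
Proof.
rewrite /has_3periodic_orbit /piter /=; split=> [[-> [/eqP n _ _]]|[e n]].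
  by split=> // gx; apply: n.
split=> //; split; apply/eqP => E; apply: n.
- by rewrite -E.
- by rewrite -!E in e.
- by rewrite -E in e.
Qed.

Lemma f_ac_iter3P (K : fieldType) (a c : K) :
  piter (f_ac a c) 3 a = Some a <->
  exists y z, [/\ f_ac a c a = Some y, f_ac a c y = Some z
                & f_ac a c z = Some a].
Proof.
rewrite /piter /=; split=> [|[y [z [-> /= -> ]]] //].
case e1: (f_ac a c a) => [y|] //=; case e2: (f_ac a c y) => [z|] //= e3.
by exists y, z.
Qed.

Lemma h_denE (K : fieldType) (q : K) :
  6 * q ^+ 3 + 11 * q ^+ 2 + 6 * q + 1 = (q + 1) * (2 * q + 1) * (3 * q + 1).
Proof. ring. Qed.

Lemma notin_excludedP (K : fieldType) (q : K) : (2 : K) != 0 -> (3 : K) != 0 ->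
  (q \notin excluded K) =
  [&& q != 0, q + 1 != 0, 2 * q + 1 != 0, 3 * q + 1 != 0 & 3 * q + 2 != 0].
Proof.
move=> n2 n3.
have lin (m k : K) : m != 0 -> (m * q + k == 0) = (q == - (k / m)).
  move=> m0; rewrite addr_eq0 -(inj_eq (mulfI m0) q).
  by congr (_ == _); field.
by rewrite !inE !negb_or addr_eq0 !lin.
Qed.

(** The condition [a + c != 0] says that [a] is not a fixed point; it does not
  follow from the parametrization by [q]. *)
Lemma f_ac_3periodicP (K : fieldType) (a c : K) :
    a != 0 -> (2 : K) != 0 -> (3 : K) != 0 ->
  has_3periodic_orbit (f_ac a c) a <->
  a + c != 0 /\
    exists2 q : K, q \notin excluded K & (h q, q * h q - 1) = (a, c).
Proof.
move=> a0 n2 n3; rewrite has_3periodic_orbit_notfixed f_ac_fixed// f_ac_iter3P.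
split.
  case=> -[y [z [/f_acP[A0 eA] /f_acP[B0 eB] /f_acP[C0 eC]]]] /eqP ac0.
  split=> //.
  (* q is the inverse of f a, minus one *)
  pose q := (c + 1) / a; have cE : c = q * a - 1 by rewrite /q; field.
  have yq : y * (q + 1) = 1.
    apply: (mulfI a0); apply: (mulfI a0).
    by rewrite mulr1 -eA cE; ring.
  have q1 : q + 1 != 0.
    by apply: contra_eq_neq yq => ->; rewrite mulr0 eq_sym oner_eq0.
  have ey : y = (q + 1)^-1 by apply: (mulIf q1); rewrite yq mulVf.
  (* D is the denominator of z = f (f a), cleared of powers of q + 1 *)
  pose D := a * (q + 1) * (2 * q + 1) - q.
  have zD : z * D = a * (q + 1).
    have -> : a * (q + 1) = (q + 1) ^+ 2 * (a * y) by rewrite ey; field.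
    by rewrite -eB cE ey /D; field.
  have zC : z ^+ 2 + c * z + a = z by apply: (mulfI a0).
  (* f z = a, multiplied by D ^ 2, factors with the nonzero cofactors a, b1 *)
  have ha : a * ((q + 1) * (2 * q + 1) * (3 * q + 1)) = 3 * q ^+ 2 + 2 * q.
    apply/eqP; rewrite -subr_eq0.
    have b1 : a * (q + 1) - 1 != 0.
      by move: ac0; rewrite cE; apply: contraNneq => <-; apply/eqP; ring.
    rewrite -(mulrI_eq0 _ (mulfI b1)) -(mulrI_eq0 _ (mulfI a0)); apply/eqP.
    transitivity ((z * D) ^+ 2 + (c - 1) * (z * D) * D + a * D ^+ 2).
      by rewrite zD cE /D; ring.
    transitivity (D ^+ 2 * (z ^+ 2 + c * z + a - z)); first by ring.
    by rewrite zC subrr mulr0.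
  (* a root of one of the linear forms below contradicts ha or a != 0 *)
  have inex : q \notin excluded K.
    rewrite notin_excludedP// q1 /=; apply/and4P; split.
    - apply: contraNneq a0 => q0; move: ha; rewrite q0.
      by rewrite !(mulr0, expr0n, add0r, mulr1)/= => ->.
    - apply: contraNneq (oner_neq0 K) => q2; apply/eqP.
      transitivity ((2 * q + 1) * (6 * q + 1) - 4 * (3 * q ^+ 2 + 2 * q)).
        by ring.
      by rewrite -ha q2; ring.
    - apply: contraNneq (oner_neq0 K) => q3; apply/eqP.
      transitivity ((3 * q + 1) ^+ 2 - 3 * (3 * q ^+ 2 + 2 * q)).
        by ring.
      by rewrite -ha q3; ring.
    (* 9 (q + 1) (2 q + 1) (3 q + 1) = 1 + x (2 x ^ 2 - x - 2) *)
    - apply: contraNneq a0 => q4; apply/eqP.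
      pose x := 3 * q + 2.
      transitivity (9 * (3 * q ^+ 2 + 2 * q) - a * (x * (2 * x ^+ 2 - x - 2))).
        by rewrite -ha /x; ring.
      transitivity (9 * (q * (3 * q + 2)) - a * (x * (2 * x ^+ 2 - x - 2))).
        by ring.
      by rewrite /x q4; ring.
  exists q => //.
  move: inex; rewrite notin_excludedP// => /and5P[_ _ q2 q3 _].
  suff -> : h q = a by rewrite -cE.
  by rewrite /h h_denE -ha mulfK// !mulf_neq0.
case=> ac0 [q]; rewrite notin_excludedP// => /and5P[q0 q1 q2 q3 q4] [ha hc].
split; last exact/eqP.
have aE : a = q * (3 * q + 2) / ((q + 1) * (2 * q + 1) * (3 * q + 1)).
  by rewrite -ha /h h_denE; congr (_ / _); ring.
have cE : c = q * a - 1 by rewrite -hc ha.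
exists (q + 1)^-1, ((3 * q + 2) / (2 * q + 1)); split; apply/f_acP.
- have -> : a ^+ 2 + c * a + a = a ^+ 2 * (q + 1) by rewrite cE; ring.
  by split; [rewrite !mulf_neq0|field].
- have -> : (q + 1)^-1 ^+ 2 + c / (q + 1) + a
     = q / ((3 * q + 1) * (q + 1) ^+ 2).
    by rewrite cE aE; field; rewrite q1 q2 q3.
  split; first by rewrite !mulf_neq0 ?invr_eq0 ?mulf_neq0 ?expf_neq0.
  by rewrite aE; field; rewrite q1 q2 q3.
- have -> : ((3 * q + 2) / (2 * q + 1)) ^+ 2
       + c * ((3 * q + 2) / (2 * q + 1)) + a = (3 * q + 2) / (2 * q + 1).
    by rewrite cE aE; field; rewrite q1 q2 q3.
  by split=> //; rewrite mulf_neq0 ?invr_eq0.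
Qed.

(** With [a = h q] and [c = q a - 1], [a + c = 0] reads [h q = 1 / (q + 1)],
  hence [3 q^2 + 3 q + 1 = 0], and the conclusion is this quadratic equation
  rewritten for [1 / (q + 1)]. *)
Lemma h_fixed (K : fieldType) (q : K) : q \notin excluded K ->
  (2 : K) != 0 -> (3 : K) != 0 ->
  h q + (q * h q - 1) = 0 -> h q ^+ 2 - 3 * h q + 3 = 0.
Proof.
move=> + n2 n3; rewrite notin_excludedP// => /and5P[q0 q1 q2 q3 _] E.
have hE : h q = (q + 1)^-1.
  apply: (mulIf q1); rewrite mulVf//.
  by apply/eqP; rewrite -subr_eq0 -E; apply/eqP; ring.
have : h q = (3 * q ^+ 2 + 2 * q) / ((q + 1) * (2 * q + 1) * (3 * q + 1)).
  by rewrite /h h_denE.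
have den0 : (q + 1) * (2 * q + 1) * (3 * q + 1) != 0 by rewrite !mulf_neq0.
rewrite hE => /(congr1 ( *%R^~ ((q + 1) * (2 * q + 1) * (3 * q + 1)))) /=.
rewrite mulfVK// => E'.
have E3 : 3 * q ^+ 2 + 3 * q + 1 = 0.
  transitivity ((q + 1)^-1 * ((q + 1) * (2 * q + 1) * (3 * q + 1))
                - (3 * q ^+ 2 + 2 * q)); last by rewrite E' subrr.
  by field.
transitivity ((3 * q ^+ 2 + 3 * q + 1) / (q + 1) ^+ 2); first by field.
by rewrite E3 mul0r.
Qed.

(** * The p-adic norm *)

Section PadicNorm.
Variables (p : nat) (p_pr : prime p) (R : realType).
Implicit Types x y : Qp p_pr.

Lemma cauchy_fun_nat (n k : nat) : (n%:R : cauchy_seq p_pr) k = n%:R.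
Proof. by elim: n => // n IH; rewrite -addn1 !natrD -IH. Qed.

Lemma padic_norm_nat (n : nat) :
  padic_norm R (n%:R : Qp p_pr) = ratr (padic_abs p n%:R).
Proof.
have -> : (n%:R : Qp p_pr) = \pi_(Qp p_pr) n%:R by rewrite rmorph_nat.
apply: (@cvg_unique _ _ (fmap (fun k =>
  ratr (padic_abs p ((n%:R : cauchy_seq p_pr) k)) : R) \oo)).
- exact: norm_hausdorff.
- exact: cvg_padic_norm.
rewrite [X in fmap X _](_ : _ = (fun => ratr (padic_abs p n%:R))).
  exact: cvg_cst.
by apply/funext => k; rewrite cauchy_fun_nat.
Qed.

(** Characteristic zero is visible on the norms of the integers. *)
Lemma Qp_natr_neq0 (n : nat) : (0 < n)%N -> (n%:R : Qp p_pr) != 0.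
Proof.
move=> n0; apply/eqP => /(congr1 (padic_norm R)).
rewrite -[0 in RHS]/(0%:R) !padic_norm_nat padic_abs0.
move=> /(fmorph_inj ratr) /eqP; by rewrite padic_abs_eq0// pnatr_eq0 gtn_eqF.
Qed.

Lemma padic_normM x y : padic_norm R (x * y) = padic_norm R x * padic_norm R y.
Proof.
elim/quotW: x => u; elim/quotW: y => v; rewrite -rmorphM.
apply: (@cvg_unique _ _ (fmap (fun k =>
  ratr (padic_abs p ((u * v) k)) : R) \oo)).
- exact: norm_hausdorff.
- exact: cvg_padic_norm.
rewrite [X in fmap X _](_ : _ = (fun n =>
    ratr (padic_abs p (u n)) * ratr (padic_abs p (v n)) : R)).
  by apply: cvgM; exact: cvg_padic_norm.
by apply/funext => n; rewrite -rmorphM -padic_absM.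
Qed.

(** The terms of a Cauchy sequence that is not null stay away from 0 and become
  arbitrarily close, so by the isosceles property their absolute values are
  eventually constant: the norm is attained, not just approached. *)
Lemma padic_norm_near (u : cauchy_seq p_pr) : \pi_(Qp p_pr) u != 0 ->
  \forall n \near \oo,
    u n != 0 /\ padic_norm R (\pi_(Qp p_pr) u) = ratr (padic_abs p (u n)).
Proof.
move=> u0.
have cu : padic_cauchy p u by apply/asboolP; exact: cauchy_funP.
have nu : ~ padic_null p u.
  move=> nu; move/eqP: u0; apply; apply/eqP.
  rewrite -[0](rmorph0 \pi_(Qp p_pr)) -Quotient.idealrBE subr0.
  exact/asboolP.
have [d d0 [N uN]] := padic_nonnull p_pr cu nu.
have [K uK] := cu _ d0.
exists (maxn N K) => // n; rewrite /= geq_max => /andP[Nn Kn]; split.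
  by rewrite -(padic_abs_eq0 p_pr) gt_eqF// (lt_le_trans d0) ?uN.
apply: (@cvg_unique _ _ (fmap (fun k => ratr (padic_abs p (u k)) : R) \oo)).
- exact: norm_hausdorff.
- exact: cvg_padic_norm.
apply: cvg_near_cst; exists (maxn N K) => // m.
rewrite /= geq_max => /andP[Nm Km]; congr ratr.
apply: padic_abs_isosceles => //.
by apply: lt_le_trans (uN n Nn); exact: uK.
Qed.

Lemma padic_norm_expz x : x != 0 ->
  exists k : int, padic_norm R x = p%:R ^ k.
Proof.
elim/quotW: x => u /padic_norm_near[N _ /(_ N (leqnn N))[uN ->]].
by rewrite /padic_abs (negbTE uN) fmorphXz rmorph_nat; eexists.
Qed.

Lemma padic_norm0 : padic_norm R (0 : Qp p_pr) = 0.
Proof. by rewrite -[0 in LHS]/(0%:R) padic_norm_nat padic_abs0 rmorph0. Qed.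

Lemma padic_norm_ge0 x : 0 <= padic_norm R x.
Proof.
have [->|/padic_norm_expz[k ->]] := eqVneq x 0; first by rewrite padic_norm0.
by rewrite exprz_ge0.
Qed.

Lemma padic_norm_ultra x y :
  padic_norm R (x + y) <= Num.max (padic_norm R x) (padic_norm R y).
Proof.
have [->|x0] := eqVneq x 0; first by rewrite add0r le_max lexx orbT.
have [->|y0] := eqVneq y 0; first by rewrite addr0 le_max lexx.
have [->|] := eqVneq (x + y) 0.
  by rewrite padic_norm0 le_max padic_norm_ge0.
elim/quotW: x x0 => u u0; elim/quotW: y y0 => v v0.
rewrite -rmorphD => uv0.
near \oo => n.
have [_ ->] : u n != 0 /\
    padic_norm R (\pi_(Qp p_pr) u) = ratr (padic_abs p (u n)).
  by near: n; exact: padic_norm_near.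
have [_ ->] : v n != 0 /\
    padic_norm R (\pi_(Qp p_pr) v) = ratr (padic_abs p (v n)).
  by near: n; exact: padic_norm_near.
have [_ ->] : (u + v) n != 0 /\
    padic_norm R (\pi_(Qp p_pr) (u + v)) = ratr (padic_abs p ((u + v) n)).
  by near: n; exact: padic_norm_near.
by rewrite le_max !ler_rat -le_max; exact: padic_abs_ultra.
Unshelve. all: by end_near. Qed.

Lemma padic_norm1 : padic_norm R (1 : Qp p_pr) = 1.
Proof. by rewrite -[1 in LHS]/(1%:R) padic_norm_nat padic_abs1// rmorph1. Qed.

Lemma padic_normN x : padic_norm R (- x) = padic_norm R x.
Proof.
suff N1 : padic_norm R (-1 : Qp p_pr) = 1.
  by rewrite -mulN1r padic_normM N1 mul1r.
apply/eqP; rewrite -(@pexpr_eq1 _ _ 2) ?padic_norm_ge0//.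
by rewrite expr2 -padic_normM mulrNN mulr1 padic_norm1.
Qed.

(** If [x] had norm > 1 then [y] would have norm < 1, so [x + y] would be as
  large as [x]; hence both norms are <= 1, and their product is 1. In terms of
  polynomials: the roots of [X^2 - s X + t] with [s] integral and [t] a unit
  are units. *)
Lemma padic_norm_vieta_unit x y :
  padic_norm R (x + y) <= 1 -> padic_norm R (x * y) = 1 -> padic_norm R x = 1.
Proof.
move=> xy1 xyE.
have le1 (u v : Qp p_pr) :
    padic_norm R (u + v) <= 1 -> padic_norm R (u * v) = 1 ->
    padic_norm R u <= 1.
  move=> uv1 uvE; rewrite leNgt; apply/negP => u1.
  have v1 : padic_norm R v < 1.
    have v0 : 0 < padic_norm R v.
      rewrite lt0r padic_norm_ge0 andbT; apply: contra_eq_neq uvE => v0.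
      by rewrite padic_normM v0 mulr0 eq_sym oner_eq0.
    by rewrite -uvE padic_normM ltr_pMl.
  have := padic_norm_ultra (u + v) (- v).
  rewrite addrK padic_normN le_max => /orP[]; rewrite leNgt => /negP; apply.
    exact: le_lt_trans uv1 u1.
  exact: lt_trans v1 u1.
apply/le_anti; rewrite (le1 _ _ xy1 xyE)/= -[leLHS]xyE padic_normM.
by rewrite ler_piMr ?padic_norm_ge0// (le1 y x)// 1?addrC 1?mulrC.
Qed.

Lemma padic_norm_prime (l : nat) : prime l ->
  padic_norm R (l%:R : Qp p_pr) = if l == p then p%:R^-1 else 1.
Proof.
move=> l_pr; rewrite padic_norm_nat /padic_abs.
rewrite pnatr_eq0 gtn_eqF ?prime_gt0// -[l%:R]/(l%:Z%:~R).
rewrite numq_int denq_int !absz_nat logn1 sub0r logn_prime//.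
rewrite eq_sym; case: eqP => [_|_] /=.
  by rewrite fmorphV expr1 rmorph_nat.
by rewrite oppr0 expr0z rmorph1.
Qed.

(** * The degenerate parameters on a sphere centred at 0 *)

(** In terms of [a = x * y]: for p = 3 the value group rules out
  [(2 a - 3)^2 = -3]; for the other p, [a] is a unit because [a] and [3 - a]
  have sum and product 3, and then so is [x], because [x] and [y] have sum and
  product [a]. *)
Lemma padic_norm_degenerate_pole x y : x + y = x * y ->
  (x * y) ^+ 2 - 3 * (x * y) + 3 = 0 -> padic_norm R x = padic_norm R (x * y).
Proof.
set a := x * y => sE aE.
have [p3|p3] := eqVneq 3%N p.
  have sq : (2 * a - 3) ^+ 2 = - 3.
    transitivity (4 * (a ^+ 2 - 3 * a + 3) - 3); first by ring.
    by rewrite aE mulr0 sub0r.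
  have n3 : padic_norm R (3 : Qp p_pr) = p%:R^-1.
    by rewrite (padic_norm_prime 3%N)// p3 eqxx.
  have p0 : (0 : R) < p%:R by rewrite ltr0n prime_gt0.
  have p1 : p%:R != 1 :> R by rewrite pnatr_eq1 gtn_eqF ?prime_gt1.
  move/(congr1 (padic_norm R)): sq; rewrite padic_normN n3 expr2 padic_normM.
  have [->|/padic_norm_expz[k ->]] := eqVneq (2 * a - 3) 0.
    by rewrite padic_norm0 mul0r => /esym/eqP; rewrite invr_eq0 gt_eqF.
  rewrite -expfzDr ?gt_eqF// -[_^-1]/(_ ^ (-1)) => /(ieexprIz p0 p1).
  (* now k + k = - 1, which is odd *)
  by lia.
have n3 : padic_norm R (3 : Qp p_pr) = 1.
  by rewrite (padic_norm_prime 3%N)// (negbTE p3).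
have a1 : padic_norm R a = 1.
  apply: (padic_norm_vieta_unit a (3 - a)); first by rewrite addrC subrK n3.
  have -> // : a * (3 - a) = 3.
  transitivity (3 - (a ^+ 2 - 3 * a + 3)); first by ring.
  by rewrite aE subr0.
by rewrite a1; apply: (padic_norm_vieta_unit x y); rewrite ?sE a1.
Qed.

(** The pole [(a + s) / 2] of [f] lies on the sphere. *)
Lemma fixed_parameter_not_invariant (a s : Qp p_pr) :
  a ^+ 2 - 3 * a + 3 = 0 -> s ^+ 2 = a ^+ 2 - 4 * a ->
  ~ invariant_set (f_ac a (- a)) (padic_sphere 0 (padic_norm R a)).
Proof.
move=> aE sE inv.
have n2 : (2 : Qp p_pr) != 0 by exact: Qp_natr_neq0.
have n4 : (4 : Qp p_pr) != 0 by exact: Qp_natr_neq0.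
pose x := (a + s) / 2; pose y := (a - s) / 2.
have xyD : x + y = a by rewrite /x /y; field.
have xyM : x * y = a.
  transitivity ((a ^+ 2 - s ^+ 2) / 4).
    by rewrite /x /y; field; rewrite n2 n4.
  by rewrite sE; field.
have xS : padic_sphere 0 (padic_norm R a) x.
  rewrite /padic_sphere /= subr0.
  by rewrite (padic_norm_degenerate_pole x y) xyM ?xyD.
have [//|z + _] := inv x xS 1%N; rewrite /piter /= => /f_acP[/eqP[]].
transitivity (x ^+ 2 - (x + y) * x + x * y); last by ring.
by rewrite xyD xyM mulNr.
Qed.

End PadicNorm.

Theorem theorem9 (p : nat) (p_pr : prime p) (R : realType) (a c : Qp p_pr)
    (ac_neq0 : a * c != 0)
    (sqrt_disc : exists s : Qp p_pr, s ^+ 2 = c ^+ 2 - 4 * a)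
    (r : R) (r_gt0 : 0 < r) :
  (invariant_set (f_ac a c) (padic_sphere 0 r) ->
   padic_sphere 0 r a ->
     (has_3periodic_orbit (f_ac a c) a <->
      [set (h q, q * h q - 1) | q in
         [set q : Qp p_pr | q \notin excluded (Qp p_pr) /\
                            padic_norm R (h q) = r]] (a, c))) /\
  (invariant_set (f_ac a c) (padic_sphere (- c) r) ->
   padic_sphere (- c) r a ->
     (has_3periodic_orbit (f_ac a c) a <->
      [set (h q, q * h q - 1) | q in
         [set q : Qp p_pr | q \notin excluded (Qp p_pr) /\
                            padic_norm R (h q * (q + 1) - 1) = r]] (a, c))).
Proof.
have n2 : (2 : Qp p_pr) != 0 by exact: Qp_natr_neq0.
have n3 : (3 : Qp p_pr) != 0 by exact: Qp_natr_neq0.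
have [a0 _] : a != 0 /\ c != 0 by move: ac_neq0; rewrite mulf_eq0 => /norP.
split=> inv; rewrite /padic_sphere /= => aS; rewrite f_ac_3periodicP//.
  rewrite subr0 in aS; split=> [[_ [q qex hq]]|[q [qex _] hq]].
    by exists q => //; split=> //; case: hq => ->.
  split; last by exists q.
  apply/eqP => ac0; have [ha hc] := hq.
  have cE : c = - a by apply/eqP; rewrite -addr_eq0 addrC ac0.
  have [s sE] := sqrt_disc.
  apply: (@fixed_parameter_not_invariant p p_pr R a s).
  - by rewrite -ha; apply: h_fixed => //; rewrite hc ha.
  - by rewrite sE cE sqrrN.
  - by rewrite aS -cE.
rewrite opprK in aS; split=> [[_ [q qex hq]]|[q [qex _] hq]].
  exists q => //; split=> //; rewrite -aS; case: hq => <- <-.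
  by congr padic_norm; ring.
split; last by exists q.
by apply: contraTneq r_gt0 => ac0; rewrite -aS ac0 padic_norm0 ltxx.
Qed.
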